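(* Let $T:\mathcal H\rightrightarrows\mathcal H$ be monotone. Fix a splitting $\mathcal H=H_*\oplus H_{**}$ and let $T_*:H_*\rightrightarrows H_*$ be the projected mapping of $T$ relative to this splitting. Then the following are equivalent: (a) For some $c>0$ and some aligned $B$, the $(c,B)$-step for $T$ is implementable. (b) The projected mapping $T_*:H_*\rightrightarrows H_*$ is maximal monotone. (c) For every $c>0$ and every aligned $B$, the $(c,B)$-step for $T$ is implementable (that is, the aligned semidefinite proximal scheme for $T$ is implementable).
   Context: $\mathcal H$ is a finite-dimensional Hilbert space with an orthogonal decomposition (splitting) $\mathcal H=H_*\oplus H_{**}$ into subspaces; each $z\in\mathcal H$ is written $z=(z_*,z_{**})$ with $z_*\in H_*$, $z_{**}\in H_{**}$ its orthogonal components. A self-adjoint positive semidefinite linear operator $B:\mathcal H\to\mathcal H$ is aligned with the splitting if its range is $H_*$ and its kernel is $H_{**}$. For $c>0$ and $B$ aligned, the $(c,B)$-step for $T$ is implementable if, for every $x\in\mathcal H$, the inclusion $0\in T(z)+c^{-1}B(z-x)$ has at least one solution $z\in\mathcal H$. The projected mapping $T_*:H_*\rightrightarrows H_*$ is defined by $$w_*\in T_*(z_* )\iff\exists z_{**}\in H_{**}\text{ such that }(w_*,0)\in T(z_*,z_{**}).$$ *)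

(* Defs.v *)
From HB Require Import structures.
From mathcomp Require Import all_boot all_order all_algebra sesquilinear.
From mathcomp Require Import classical_sets reals.

Set Implicit Arguments.
Unset Strict Implicit.
Unset Printing Implicit Defensive.

Import Order.TTheory GRing.Theory Num.Theory.
Local Open Scope classical_set_scope.
Local Open Scope ring_scope.

(* A finite-dimensional real Hilbert space is a vectType V over a realType R
   equipped with an inner product ip : {dot V for idfun}.  A set-valued mapping
   T : V -> set V has graph {(z, w) | T z w}. *)

Section SubspaceInnerProduct.
Variables (R : realType) (V : vectType R) (ip : {dot V for idfun}).
Variable U : {vspace V}.

Definition sub_dot (u v : subvs_of U) : R := ip (vsval u) (vsval v).

Let sub_dot_zmodl v : zmod_morphism (sub_dot ^~ v).
Proof.
move=> x y; rewrite /sub_dot (linearB vsval).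
exact: zmod_morphisml_subproof.
Qed.

Let sub_dot_zmodr u : zmod_morphism (sub_dot u).
Proof.
move=> x y; rewrite /sub_dot (linearB vsval).
exact: zmod_morphismr_subproof.
Qed.

Let sub_dot_scalel v : scalable_for *%R (sub_dot ^~ v).
Proof.
move=> a x; rewrite /sub_dot (linearZ_LR vsval).
exact: linearl_subproof.
Qed.

Let sub_dot_scaler u : scalable_for (idfun \; *%R) (sub_dot u).
Proof.
move=> a x; rewrite /sub_dot (linearZ_LR vsval).
exact: linearr_subproof.
Qed.

HB.instance Definition _ :=
  isBilinear.Build R (subvs_of U) (subvs_of U) R *%R (idfun \; *%R) sub_dot
    sub_dot_zmodl sub_dot_zmodr sub_dot_scalel sub_dot_scaler.

Let sub_dot_hermitian u v :
  sub_dot u v = (-1) ^+ false * idfun (sub_dot v u).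
Proof. exact: hermitian_subproof. Qed.

HB.instance Definition _ :=
  isHermitianSesquilinear.Build R (subvs_of U) false idfun sub_dot
    sub_dot_hermitian.

Let sub_dot_gt0 u : u != 0 -> 0 < sub_dot u u.
Proof.
move=> u0; apply: neq0_dnorm_gt0; apply: contraNneq u0 => u0.
by apply/eqP/val_inj; rewrite /= u0.
Qed.

HB.instance Definition _ :=
  isDotProduct.Build R (subvs_of U) sub_dot sub_dot_gt0.

Definition subspace_dot : {dot (subvs_of U) for idfun} := sub_dot.

End SubspaceInnerProduct.

Definition monotone (R : realType) (V : vectType R) (ip : {dot V for idfun})
    (T : V -> set V) : Prop :=
  forall z z' w w' : V, T z w -> T z' w' -> 0 <= ip (z - z') (w - w').

Definition maximal_monotone (R : realType) (V : vectType R)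
    (ip : {dot V for idfun}) (T : V -> set V) : Prop :=
  monotone ip T /\
  forall S : V -> set V, monotone ip S ->
    (forall z, T z `<=` S z) -> forall z, S z `<=` T z.

(* The sum is automatically direct, as ip is positive definite. *)
Definition splitting (R : realType) (V : vectType R) (ip : {dot V for idfun})
    (Hs Hss : {vspace V}) : Prop :=
  (Hs + Hss)%VS = fullv /\ (Hs <= orthov ip Hss)%VS.

(* The element (z_*, z_** ) of V with the given components. *)
Definition of_components (R : realType) (V : vectType R) (Hs Hss : {vspace V})
    (zs : subvs_of Hs) (zss : subvs_of Hss) : V :=
  vsval zs + vsval zss.

Definition projected_mapping (R : realType) (V : vectType R)
    (Hs Hss : {vspace V}) (T : V -> set V) : subvs_of Hs -> set (subvs_of Hs) :=
  fun zs => [set ws | exists zss : subvs_of Hss,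
    T (of_components zs zss) (of_components ws (0 : subvs_of Hss))].
Arguments projected_mapping {R V} Hs Hss T.

Definition self_adjoint (R : realType) (V : vectType R)
    (ip : {dot V for idfun}) (B : 'End(V)) : Prop :=
  forall x y : V, ip (B x) y = ip x (B y).

Definition positive_semidefinite (R : realType) (V : vectType R)
    (ip : {dot V for idfun}) (B : 'End(V)) : Prop :=
  forall x : V, 0 <= ip (B x) x.

Definition aligned (R : realType) (V : vectType R) (ip : {dot V for idfun})
    (Hs Hss : {vspace V}) (B : 'End(V)) : Prop :=
  [/\ self_adjoint ip B, positive_semidefinite ip B,
      limg B = Hs & lker B = Hss].

(* The set below is T(z) + c^-1 B(z - x). *)
Definition implementable (R : realType) (V : vectType R) (T : V -> set V)
    (c : R) (B : 'End(V)) : Prop :=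
  forall x : V, exists z : V, [set w + c^-1 *: B (z - x) | w in T z] 0.

(* Main.v *)
(* Splitting T along H_* and H_** turns the (c,B)-step into the inclusion
   c^-1 B (x - z) \in T_* z on H_*, where B restricts to a positive definite
   bijection.  If this inclusion is always solvable, a point monotonically
   related to T_* must lie in its graph, because B is definite on H_*.
   Conversely, in the inner product c^-1 <B u, v> on H_* the inclusion reads
   x - z \in S z with S maximal monotone, and solvability is Minty's theorem.
   That theorem is obtained by minimising (1/4)|a - b + y|^2 + t - <a, y> over the
   epigraph of the Fitzpatrick function of S: monotonicity puts the graph of S
   in this convex set, maximality gives t >= <a, b> on it, hence nonnegativity
   of the objective, and the variational inequality at the limit z of
   (a - b + y)/2 along a minimising sequence says exactly that (z, y - z) is
   monotonically related to S. *)

Require Import Defs.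
From HB Require Import structures.
From mathcomp Require Import all_boot all_order all_algebra sesquilinear.
From mathcomp Require Import ring lra.
From mathcomp Require Import boolp classical_sets filter reals.
From mathcomp Require Import topology normedtype sequences.
Import Order.TTheory GRing.Theory Num.Theory.
Import numFieldNormedType.Exports.
Local Open Scope classical_set_scope.
Local Open Scope ring_scope.

Set Implicit Arguments.
Unset Strict Implicit.

(** * Inner product identities, Riesz representation and weak limits of Cauchy sequences *)

Section DotLemmas.
Variables (R : realType) (V : vectType R) (ip : {dot V for idfun}).

Lemma ipC u v : ip u v = ip v u.
Proof. by rewrite hermC /= mul1r. Qed.

Lemma ipDl u v w : ip (u + v) w = ip u w + ip v w.
Proof. exact: linearDl. Qed.

Lemma ipBl u v w : ip (u - v) w = ip u w - ip v w.
Proof. exact: linearBl. Qed.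

Lemma ipZl a u w : ip (a *: u) w = a * ip u w.
Proof. exact: linearZl_LR. Qed.

Lemma ipDr u v w : ip u (v + w) = ip u v + ip u w.
Proof. exact: linearDr. Qed.

Lemma ipNl u w : ip (- u) w = - ip u w.
Proof. exact: linearNl. Qed.

Lemma ipNr u w : ip u (- w) = - ip u w.
Proof. exact: linearNr. Qed.

Lemma ipZr a u w : ip u (a *: w) = a * ip u w.
Proof. exact: linearZr_LR. Qed.

Lemma ip0r u : ip u 0 = 0.
Proof. exact: linear0r. Qed.

Definition ipE := (ipDl, ipDr, ipNl, ipNr, ipZl, ipZr).

Lemma ip_gt0 u : u != 0 -> 0 < ip u u.
Proof. exact: neq0_dnorm_gt0. Qed.

Lemma ip_ge0 u : 0 <= ip u u.
Proof. by have [->|/ip_gt0/ltW//] := eqVneq u 0; rewrite ip0r. Qed.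

Lemma ip_le0_eq0 u : ip u u <= 0 -> u = 0.
Proof. by move=> h; apply/eqP/negPn/negP => /ip_gt0; rewrite ltNge h. Qed.

Lemma ip_inj u w : (forall v, ip u v = ip w v) -> u = w.
Proof.
move=> h; apply/eqP; rewrite -subr_eq0; apply/eqP; apply: ip_le0_eq0.
by rewrite ipBl h subrr.
Qed.

Lemma ip_sqr_le u v : ip u v ^+ 2 <= ip u u * ip v v.
Proof.
have [->|v0] := eqVneq v 0; first by rewrite !ip0r expr0n mulr0.
have vv : 0 < ip v v by exact: ip_gt0.
(* This square norm equals [<v,v> (<u,u><v,v> - <u,v>^2)]. *)
have := ip_ge0 (ip v v *: u - ip u v *: v).
rewrite !ipE (ipC v u) => h.
by rewrite -(ler_pM2l vv); lra.
Qed.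

(** Riesz representation by way of the frame operator [F u = sum_i <u,b_i> b_i]. If [F u = 0],
    freeness of the basis makes every [<u,b_i>] vanish, so [u = 0]. Thus [F] is injective, hence
    onto, and a preimage of [sum_i l_i b_i] has the prescribed products. *)
Lemma dot_repr (l : 'I_(\dim (fullv : {vspace V})) -> R) :
  exists z, forall i : 'I_(\dim (fullv : {vspace V})),
    ip z (vbasis fullv)`_i = l i.
Proof.
pose b := vbasis (fullv : {vspace V}).
have bfree : free b := basis_free (vbasisP _).
pose F u := \sum_(i < \dim (fullv : {vspace V})) ip u b`_i *: b`_i.
have Flin : linear F.
  move=> a u v; rewrite /F scaler_sumr -big_split /=; apply: eq_bigr => i _.
  by rewrite !ipE scalerDl scalerA.
pose HF := GRing.isLinear.Build _ _ _ _ F Flin.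
pose F' : {linear V -> V} := HB.pack F HF.
have FE u : linfun F' u = F u by rewrite lfunE.
have ker0 : lker (linfun F') == 0%VS.
  rewrite -subv0; apply/subvP => u; rewrite memv_ker FE memv0 => /eqP Fu0.
  apply/eqP; apply: ip_le0_eq0.
  rewrite {2}(coord_vbasis (memvf u)) linear_sumr big1 //= => i _.
  rewrite ipZr -(coord_sum_free (fun i => ip u b`_i) i bfree).
  by rewrite -/(F u) Fu0 linear0 mulr0.
have : \sum_(i < \dim (fullv : {vspace V})) l i *: b`_i \in limg (linfun F').
  by rewrite (lker0_limgf ker0) memvf.
move=> /memv_imgP[z _]; rewrite FE => zE.
exists z => i; rewrite -(coord_sum_free l i bfree) zE.
by rewrite coord_sum_free.
Qed.

(** Completeness of [V] phrased through real sequences only: Cauchy-Schwarz makes each [<e_n,y>]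
    Cauchy, and [dot_repr] turns the limits along a basis into a vector. *)
Lemma cauchy_weak_cvg (e : nat -> V) :
  (forall d : R, 0 < d ->
     \forall n & m \near \oo, ip (e n - e m) (e n - e m) < d) ->
  exists z, forall y, ip (e n) y @[n --> \oo] --> ip z y.
Proof.
move=> ec.
have cv y : cvg (ip (e n) y @[n --> \oo]).
  apply/cauchy_cvgP/cauchy_ballP => eps eps0; near_simpl.
  (* The added 1 keeps the divisor positive when [y = 0]. *)
  have y1 : 0 < 1 + ip y y by rewrite ltr_pwDl ?ip_ge0.
  have := ec (eps ^+ 2 / (1 + ip y y)) (divr_gt0 (exprn_gt0 _ eps0) y1).
  apply: filterS => -[n m] /=; rewrite ltr_pdivlMr // => h.
  rewrite /ball /= -ipBl -(@ltr_pXn2r R 2) ?nnegrE ?(ltW eps0) //.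
  rewrite real_normK ?num_real //.
  apply: le_lt_trans (ip_sqr_le _ _) _; apply: le_lt_trans h.
  by rewrite ler_wpM2l ?ip_ge0 // lerDr.
have [z zE] := dot_repr (fun i : 'I_(\dim (fullv : {vspace V})) =>
  lim (ip (e n) (vbasis fullv)`_i @[n --> \oo])).
exists z => y.
have yE u : ip u y = \sum_(i < \dim (fullv : {vspace V}))
    coord (vbasis fullv) i y * ip u (vbasis fullv)`_i.
  rewrite {1}(coord_vbasis (memvf y)) linear_sumr.
  by apply: eq_bigr => i _; exact: ipZr.
rewrite yE; under eq_fun do rewrite yE.
apply: cvg_big => [|i _]; first exact: add_continuous.
by apply: cvgMr; rewrite zE; exact: cv.
Unshelve. all: by end_near. Qed.

End DotLemmas.

(** * Minty's theorem by a convex variational argument *)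

Section Minty.
Variables (R : realType) (V : vectType R) (ip : {dot V for idfun}).

(** The conclusion is the first-order condition for minimising [|u|^2 + t] over [K]. Since [K] is
    not assumed closed, the infimum may not be attained; the condition is derived approximately
    along a minimising sequence and passed to its weak limit [z]. *)
Lemma convex_variational (K : V -> R -> Prop) :
  (forall u v s t (a : R), 0 <= a <= 1 -> K u s -> K v t ->
     K (u + a *: (v - u)) (s + a * (t - s))) ->
  (forall u t, K u t -> 0 <= ip u u + t) ->
  exists z, forall u t, K u t -> 0 <= t + 2 * ip z u - ip z z.
Proof.
move=> Kconv Kge0.
have [[u0 [t0 K0]]|nK] := pselect (exists u t, K u t); last first.
  by exists 0 => u t Kut; case: nK; exists u, t.
pose E := [set ip p.1 p.1 + p.2 | p in [set p : V * R | K p.1 p.2]].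
have E0 : E !=set0 by exists (ip u0 u0 + t0), (u0, t0).
have lb0 : lbound E 0 by move=> _ [p /Kge0 ? <-].
have m_ge0 : 0 <= inf E by exact: lb_le_inf.
have m_le u t : K u t -> inf E <= ip u u + t.
  by move=> Kut; apply: ge_inf; [exists 0|exists (u, t)].
have m_adh eps : 0 < eps -> exists2 g, E g & g < inf E + eps.
  by move=> eps0; apply: inf_adherent => //; split=> //; exists 0.
move: (inf E) m_ge0 m_le m_adh => m m_ge0 m_le m_adh.
pose d : nat -> R := harmonic.
have d_gt0 n : 0 < d n by rewrite /d /harmonic /= invr_gt0.
have d_le1 n : d n <= 1 by rewrite /d /harmonic /= invf_le1 // ler1n.
(* The gap is [d n ^+ 2] so that it still vanishes after the later division by [d n]. *)
have /choice[e eP] n : exists p : V * R,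
    K p.1 p.2 /\ ip p.1 p.1 + p.2 < m + d n ^+ 2.
  by have [_ [p Kp <-] pm] := m_adh _ (exprn_gt0 2 (d_gt0 n)); exists p.
have e_dist i j :
    ip ((e i).1 - (e j).1) ((e i).1 - (e j).1) <= 2 * (d i ^+ 2 + d j ^+ 2).
  have [Ki gi] := eP i; have [Kj gj] := eP j.
  (* Parallelogram law: the midpoint of two near-minimisers also has value at least [m]. *)
  have := m_le _ _ (Kconv _ _ _ _ 2^-1 _ Ki Kj).
  rewrite !ipE (ipC ip (e j).1 (e i).1).
  by rewrite invr_ge0 ler0n invf_le1 // ler1n => /(_ isT); lra.
have d_cvg : d @ \oo --> 0 by exact: cvg_harmonic.
have [|z zP] := @cauchy_weak_cvg R V ip (fun n => (e n).1).
  move=> r r0.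
  have : \forall n \near \oo, d n < r / 4.
    by apply: (cvgr_lt _ d_cvg); rewrite divr_gt0.
  move=> near_d; near=> i j => /=.
  have di : d i < r / 4 by near: i.
  have dj : d j < r / 4 by near: j.
  apply: le_lt_trans (e_dist i j) _.
  have sq n : d n ^+ 2 <= d n.
    by rewrite expr2 -[leRHS]mulr1 ler_wpM2l // ltW.
  have := sq i; have := sq j; lra.
exists z => u t Kut; apply: le_trans m_ge0 _.
(* Bounds [|u - e_n|^2] for all [n]: it is at most [2|u - e_0|^2 + 2|e_0 - e_n|^2], and [e_dist]
   with [d <= 1] bounds the last term by 8. *)
pose C := 2 * ip (u - (e 0).1) (u - (e 0).1) + 8.
(* Step d n from e_n towards (u, t), divide by d n, and replace |e_n|^2 by its
   lower bound 2 <e_n, z> - |z|^2, which passes to the weak limit. *)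
have bound n : m - d n * (1 + C) <=
    t + 2 * ip (e n).1 u - 2 * ip (e n).1 z + ip z z.
  have [Kn gn] := eP n; have gm := m_le _ _ Kn.
  have NC : ip (u - (e n).1) (u - (e n).1) <= C.
    have := e_dist 0%N n; have := ip_ge0 ip ((u - (e 0).1) - ((e 0).1 - (e n).1)).
    have : d 0 ^+ 2 <= 1 by rewrite exprn_ile1 // ltW.
    have : d n ^+ 2 <= 1 by rewrite exprn_ile1 // ltW.
    rewrite /C !ipE (ipC ip (e 0).1 u) (ipC ip (e n).1 u).
    by rewrite (ipC ip (e n).1 (e 0).1); lra.
  have dn01 : 0 <= d n <= 1 by rewrite d_le1 ltW.
  have := m_le _ _ (Kconv _ _ _ _ _ dn01 Kn Kut).
  have := ip_ge0 ip ((e n).1 - z).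
  move: NC gm gn (d_gt0 n); rewrite !ipE (ipC ip z (e n).1) (ipC ip u (e n).1).
  move: (d n) => s NC gm gn s0.
  have hN := ler_wpM2l (exprn_ge0 2 (ltW s0)) NC.
  have hm := ler_wpM2l (ltW s0) gm.
  move=> /(ler_wpM2l (ltW s0)) hz h.
  rewrite -(ler_pM2l s0); lra.
have lhs_cvg : m - d n * (1 + C) @[n --> \oo] --> m - 0 * (1 + C).
  by apply: cvgB; [exact: cvg_cst|apply: cvgMl].
have rhs_cvg : t + 2 * ip (e n).1 u - 2 * ip (e n).1 z + ip z z @[n --> \oo] -->
    t + 2 * ip z u - 2 * ip z z + ip z z.
  apply: cvgD; last exact: cvg_cst.
  by apply: cvgB; [apply: cvgD; first exact: cvg_cst|]; apply: cvgMr; exact: zP.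
have := ler_cvg_to lhs_cvg rhs_cvg (nearW _ bound).
rewrite mul0r subr0 => /(_ _ _); lra.
Unshelve. all: by end_near. Qed.

(** Adjoining the single pair [(z, w)] to the graph keeps it monotone, so maximality puts the pair
    in [S]. *)
Lemma maximal_monotone_related (S : V -> set V) z w :
  maximal_monotone ip S ->
  (forall z' w', S z' w' -> 0 <= ip (z - z') (w - w')) -> S z w.
Proof.
move=> [Smono Smax] zw.
apply: (Smax (fun a => [set b | S a b \/ (a = z /\ b = w)])); last by right.
- move=> a a' b b' [Sab|[-> ->]] [Sab'|[-> ->]].
  + exact: Smono.
  + by have := zw _ _ Sab; rewrite !ipE; lra.
  + exact: zw.
  + by rewrite !subrr ip0r.
- by move=> a b; left.
Qed.

Lemma minty (S : V -> set V) y :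
  maximal_monotone ip S -> exists z, S z (y - z).
Proof.
move=> Smax; have Smono := Smax.1.
(* [(a, b, t)] lies in the epigraph of the Fitzpatrick function, the supremum of
   [<a,w> + <z,b> - <z,w>] over the graph of [S]. *)
pose fitz a b t := forall z w, S z w -> ip a w + ip z b <= t + ip z w.
have fitz_ge a b t : fitz a b t -> ip a b <= t.
  (* If [t < <a,b>], then [F] makes [(a, b)] monotonically related to [S], hence a point of its
     graph; testing [F] at that very point gives [<a,b> <= t]. *)
  move=> F; rewrite leNgt; apply/negP => tab.
  have /F : S a b.
    apply: (maximal_monotone_related Smax) => z w /F.
    rewrite !ipE; lra.
  lra.
pose K u r := exists a b t,
  [/\ fitz a b t, u = 2^-1 *: (a - b + y) & r = t - ip a y].
have [||z zP] := @convex_variational K.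
- move=> _ _ _ _ c /andP[c0 c1] [a [b [t [F -> ->]]]] [a' [b' [t' [F' -> ->]]]].
  exists (a + c *: (a' - a)), (b + c *: (b' - b)), (t + c * (t' - t)); split.
  + move=> z w Szw; rewrite !ipE.
    have := ler_wpM2l c0 (F' _ _ Szw).
    have c1' : 0 <= 1 - c by rewrite subr_ge0.
    have := ler_wpM2l c1' (F _ _ Szw); lra.
  + by apply: (@ip_inj R V ip) => v; rewrite !ipE; ring.
  + rewrite !ipE; ring.
- move=> _ _ [a [b [t [/fitz_ge F -> ->]]]].
  (* Uses [|a - b + y|^2 / 4 - <a,y> = |a + b - y|^2 / 4 - <a,b>]. *)
  have := ip_ge0 ip (a + b - y).
  rewrite !ipE (ipC ip b a) (ipC ip y a) (ipC ip y b); lra.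
exists z; apply: (maximal_monotone_related Smax) => a b Sab.
have /zP : K (2^-1 *: (a - b + y)) (ip a b - ip a y).
  exists a, b, (ip a b); split=> // z' w' Szw.
  have := Smono _ _ _ _ Sab Szw; rewrite !ipE; lra.
by rewrite !ipE (ipC ip a z); lra.
Qed.

End Minty.

(** Serves to make [c^-1 <B u, v>] on [Hs] an inner product to which [minty] applies. *)
Lemma dot_of_form (R : realType) (V : lmodType R) (f : V -> V -> R) :
  (forall w, scalar (f ^~ w)) -> (forall u v, f u v = f v u) ->
  (forall u, u != 0 -> 0 < f u u) ->
  exists g : {dot V for idfun}, forall u v, g u v = f u v.
Proof.
move=> flin fC fpos.
have flinr u : scalar (f u).
  by move=> a v w; rewrite !(fC u) flin.
pose fB := bilinear_isBilinear.Build R V V R *%R (idfun \; *%R) f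
  (conj flin flinr : bilinear_for *%R (idfun \; *%R) f).
have fH u v : f u v = (-1) ^+ false * idfun (f v u) by rewrite mul1r fC.
pose fHerm := isHermitianSesquilinear.Build R V false idfun f fH.
pose fD := isDotProduct.Build R V f fpos.
pose g : {dot V for idfun} := HB.pack f fB fHerm fD.
by exists g.
Qed.

(** * Reduction of the step to [Hs], and maximality of the projected mapping *)

Section Projected.
Variables (R : realType) (V : vectType R) (ip : {dot V for idfun}).
Variables (T : V -> set V) (Hs Hss : {vspace V}).
Hypothesis split : splitting ip Hs Hss.

Lemma splitting_orth u v : u \in Hs -> v \in Hss -> ip u v = 0.
Proof. by move=> uH vH; exact: (orthovP split.2). Qed.

Lemma splitting_cap : (Hs :&: Hss = 0)%VS.
Proof.
apply/eqP; rewrite -subv0; apply/subvP => u; rewrite memv_cap => /andP[us uss].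
by rewrite memv0; apply/eqP/(ip_le0_eq0 (ip := ip)); rewrite splitting_orth.
Qed.

Lemma of_componentsP v :
  exists (zs : subvs_of Hs) (zss : subvs_of Hss), v = of_components zs zss.
Proof.
have : v \in (Hs + Hss)%VS by rewrite split.1 memvf.
move=> /memv_addP[u us [w ws ->]].
by exists (vsproj Hs u), (vsproj Hss w); rewrite /of_components !vsprojK.
Qed.

Lemma dot_components (zs ws : subvs_of Hs) (zss : subvs_of Hss) :
  ip (of_components zs zss) (vsval ws) = subspace_dot ip Hs zs ws.
Proof.
rewrite /of_components ipDl (ipC ip (vsval zss)).
by rewrite (splitting_orth (subvsP ws) (subvsP zss)) addr0.
Qed.

(** The images in [T] have zero [Hss] component, so the hidden coordinates [y], [y'] drop out of the
    pairing. *)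
Lemma projected_monotone :
  monotone ip T -> monotone (subspace_dot ip Hs) (projected_mapping Hs Hss T).
Proof.
move=> Tmono z z' w w' [y Tzw] [y' Tzw'].
have := Tmono _ _ _ _ Tzw Tzw'.
rewrite -(dot_components (z - z') (w - w') (y - y')) /of_components.
by rewrite !linear0 !addr0 opprD addrACA !linearB.
Qed.

Variable B : 'End(V).
Hypothesis alignedB : aligned ip Hs Hss B.

Lemma aligned_mem v : B v \in Hs.
Proof. by have [_ _ <- _] := alignedB; exact: memv_img (memvf v). Qed.

Lemma aligned_components (zs : subvs_of Hs) (zss : subvs_of Hss) :
  B (of_components zs zss) = B (vsval zs).
Proof.
have [_ _ _ kerB] := alignedB.
rewrite /of_components linearD /= [X in _ + X](_ : _ = 0) ?addr0 //.
by apply/eqP; rewrite -memv_ker kerB subvsP.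
Qed.

(** A preimage can be cut down to its [Hs] component because [B] kills the rest. *)
Lemma aligned_surj (w : subvs_of Hs) :
  exists v : subvs_of Hs, B (vsval v) = vsval w.
Proof.
have [_ _ imB _] := alignedB.
have : vsval w \in limg B by rewrite imB subvsP.
move=> /memv_imgP[v _ ->]; have [zs [zss ->]] := of_componentsP v.
by exists zs; rewrite aligned_components.
Qed.

(** For a semidefinite [B], [<B u, u> = 0] forces [B u = 0]; then [u] lies in both [Hs] and the
    kernel [Hss], so it is zero. *)
Lemma aligned_gt0 (u : subvs_of Hs) : u != 0 -> 0 < ip (B (vsval u)) (vsval u).
Proof.
move=> u0; have [saB psB _ kerB] := alignedB.
rewrite lt_neqAle psB andbT eq_sym; apply: contra_neq u0 => qu0.
have Bu0 : B (vsval u) = 0.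
  apply: (ip_le0_eq0 (ip := ip)); set v := B (vsval u).
  (* Positivity at (k+1)u - <v,v>v, k = <Bv,v>, gives -(k+2)<v,v>^2 >= 0. *)
  have k0 : 0 <= ip (B v) v := psB v.
  rewrite leNgt; apply/negP => v0.
  have BE a b : B (a *: vsval u - b *: v) = a *: v - b *: B v.
    by rewrite linearB !linearZ.
  have := psB ((ip (B v) v + 1) *: vsval u - ip v v *: v).
  rewrite BE !ipE (saB v (vsval u)) -/v.
  rewrite -/v in qu0; rewrite qu0 leNgt => /negP; apply.
  have := mulr_gt0 v0 v0; have := mulr_ge0 k0 (ltW (mulr_gt0 v0 v0)); lra.
apply/val_inj/eqP; rewrite /= -memv0 -splitting_cap memv_cap subvsP -kerB.
by rewrite memv_ker Bu0 eqxx.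
Qed.

(** The range of [B] forces the selected value of [T] into [Hs], and its kernel removes the [Hss]
    components of [x] and [z] from [B (x - z)]. The remaining free [Hss] component of [z] is the
    existential witness in the projected mapping. *)
Lemma implementableP (c : R) : 0 < c ->
  implementable T c B <->
  forall x : subvs_of Hs, exists z v : subvs_of Hs,
    projected_mapping Hs Hss T z v /\ vsval v = c^-1 *: B (vsval (x - z)).
Proof.
move=> c0; split=> [imp x|h x].
- have [z [w Tzw /eqP]] := imp (vsval x).
  rewrite addr_eq0 => /eqP wBE.
  have wE : w = c^-1 *: B (vsval x - z).
    by rewrite wBE -[z - _]opprB linearN scalerN opprK.
  have [zs [zss zE]] := of_componentsP z.
  have wH : w \in Hs by rewrite wE rpredZ ?aligned_mem.
  exists zs, (vsproj Hs w); rewrite vsprojK //; split.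
    exists zss; rewrite -zE.
    by rewrite /of_components vsprojK // linear0 addr0.
  rewrite wE zE [vsval (_ - _)]linearB ![B (_ - _)]linearB /=.
  by rewrite aligned_components.
- have [xs [xss xE]] := of_componentsP x.
  have [zs [v [[zss Tzv] vE]]] := h xs.
  exists (of_components zs zss), (of_components v (0 : subvs_of Hss)) => //.
  rewrite {1}/of_components linear0 addr0 vE xE.
  rewrite [vsval (_ - _)]linearB ![B (_ - _)]linearB /= !aligned_components.
  by rewrite -scalerDr addrC subrKA subrr scaler0.
Qed.

Lemma implementable_maximal (c : R) : 0 < c -> monotone ip T ->
  implementable T c B ->
  maximal_monotone (subspace_dot ip Hs) (projected_mapping Hs Hss T).
Proof.
move=> c0 Tmono /(implementableP c0) imp; split; first exact: projected_monotone.
move=> S Smono TS z0 w0 Szw0.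
have [v vE] := aligned_surj w0.
(* With [B v = w0], this base point makes the solution satisfy [w0 - w = - c^-1 B (z0 - z)].
   Monotonicity then gives [<B (z0 - z), z0 - z> <= 0], so [z = z0] and [w = w0]. *)
have [z [w [Tzw wE]]] := imp (z0 + c *: v).
have := Smono _ _ _ _ Szw0 (TS _ _ Tzw).
have dE : vsval (w0 - w) = - (c^-1 *: B (vsval (z0 - z))).
  have BE : B (vsval (z0 + c *: v - z)) = B (vsval (z0 - z)) + c *: B (vsval v).
    by rewrite addrAC [vsval (_ + c *: _)]linearD [B (_ + _)]linearD !linearZ.
  rewrite [vsval (_ - _)]linearB /= wE BE -vE scalerDr scalerA.
  by rewrite mulVf ?gt_eqF // scale1r opprD addrCA subrr addr0.
rewrite /= /sub_dot dE ipNr ipZr oppr_ge0 pmulr_rle0 ?invr_gt0 // (ipC ip) => le0.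
have zz : z0 - z = 0.
  by apply/eqP/negPn/negP => /aligned_gt0; rewrite ltNge le0.
move: dE; rewrite zz !linear0 ?scaler0 ?oppr0 => /(@val_inj _ _ _ (w0 - w) 0)/eqP.
rewrite subr_eq0 => /eqP ->.
by move/eqP: zz; rewrite subr_eq0 => /eqP ->.
Qed.

Lemma maximal_implementable (c : R) : 0 < c ->
  maximal_monotone (subspace_dot ip Hs) (projected_mapping Hs Hss T) ->
  implementable T c B.
Proof.
move=> c0 Tmax; apply/(implementableP c0) => x.
have [saB _ _ _] := alignedB.
have [g gE] : exists g : {dot (subvs_of Hs) for idfun},
    forall u v, g u v = c^-1 * ip (B (vsval u)) (vsval v).
  apply: dot_of_form => [w a u v|u v|u u0].
  - by rewrite !linearP /= ipDl ipZl; ring.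
  - by rewrite saB ipC.
  - by rewrite mulr_gt0 ?invr_gt0 ?aligned_gt0.
(* [L] is [c^-1 B] restricted to [Hs], so [g u v = <L u, v>]. Pulling the values of the projected
   mapping back through [L] yields [S], and pairings of [S] in [g] are pairings of the projected
   mapping in [ip]. *)
pose L (v : subvs_of Hs) : subvs_of Hs := vsproj Hs (c^-1 *: B (vsval v)).
have LE v : vsval (L v) = c^-1 *: B (vsval v).
  by rewrite vsprojK // rpredZ ?aligned_mem.
have gL u v : g u v = subspace_dot ip Hs (L u) v by rewrite gE /= /sub_dot LE ipZl.
have LB u v : L (u - v) = L u - L v.
  by rewrite /L [vsval (_ - _)]linearB [B (_ - _)]linearB scalerBr linearB.
pose S z : set (subvs_of Hs) := [set v | projected_mapping Hs Hss T z (L v)].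
have Smax : maximal_monotone g S.
  split=> [z z' w w' Szw Szw'|S' S'mono SS' z w S'zw].
    by rewrite ipC gL LB ipC; exact: Tmax.1.
  apply: (maximal_monotone_related Tmax) => z' w' Tzw'.
  have [v vE] := aligned_surj w'.
  (* Surjectivity of [L] turns every graph point of the projected mapping into one of [S], against
     which the extension [S'] is monotone. *)
  have w'E : w' = L (c *: v).
    apply: val_inj; rewrite /= LE [vsval (_ *: _)]linearZ [B (_ *: _)]linearZ.
    by rewrite scalerA mulVf ?gt_eqF // scale1r -vE.
  rewrite w'E -LB ipC -gL ipC; apply: S'mono => //; apply: SS'.
  by rewrite /S /= -w'E.
have [z Sz] := minty x Smax.
by exists z, (L (x - z)).
Qed.

End Projected.

(** Passing from all aligned operators to some aligned operator requires that one exists; the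
    orthogonal projection onto [Hs] serves. *)
Lemma aligned_daddv_pi (R : realType) (V : vectType R) (ip : {dot V for idfun})
    (Hs Hss : {vspace V}) :
  splitting ip Hs Hss -> aligned ip Hs Hss (daddv_pi Hs Hss).
Proof.
move=> sp; have cap0 := splitting_cap sp.
have cap0' : (Hss :&: Hs = 0)%VS by rewrite capvC.
have PH v : daddv_pi Hs Hss v \in Hs by exact: memv_pi.
have QH v : daddv_pi Hss Hs v \in Hss by exact: memv_pi.
have PQ v : v = daddv_pi Hs Hss v + daddv_pi Hss Hs v.
  by rewrite daddv_pi_add // sp.1 memvf.
have Pid v : v \in Hs -> daddv_pi Hs Hss v = v by exact: daddv_pi_id.
have Qid v : v \in Hss -> daddv_pi Hss Hs v = v by exact: daddv_pi_id.
move: (daddv_pi Hs Hss) (daddv_pi Hss Hs) PH QH PQ Pid Qid => P Q PH QH PQ Pid Qid.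
(* This identity yields both self-adjointness and positivity of [P]. *)
have PP x y : ip (P x) y = ip (P x) (P y).
  have o : ip (P x) (Q y) = 0 := splitting_orth sp (PH x) (QH y).
  by rewrite {1}(PQ y) ipDr o addr0.
split.
- by move=> x y; rewrite PP (ipC ip x) (PP y) ipC.
- by move=> x; rewrite PP ip_ge0.
- apply/eqP; rewrite eqEsubv; apply/andP; split; apply/subvP => u.
    by move=> /memv_imgP[v _ ->].
  by move=> us; rewrite -(Pid u us) memv_img ?memvf.
- apply/eqP; rewrite eqEsubv; apply/andP; split; apply/subvP => u.
    by rewrite memv_ker => /eqP Pu0; rewrite (PQ u) Pu0 add0r.
  move=> us; rewrite memv_ker; apply/eqP/(addIr (Q u)).
  by rewrite -PQ add0r Qid.
Qed.

Unset Implicit Arguments.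
Set Strict Implicit.

Theorem theorem2p3 (R : realType) (V : vectType R) (ip : {dot V for idfun})
    (T : V -> set V) (Hs Hss : {vspace V}) :
  monotone ip T ->
  splitting ip Hs Hss ->
  [<-> exists (c : R) (B : 'End(V)),
         [/\ 0 < c, aligned ip Hs Hss B & implementable T c B];
       maximal_monotone (subspace_dot ip Hs) (projected_mapping Hs Hss T);
       forall (c : R) (B : 'End(V)),
         0 < c -> aligned ip Hs Hss B -> implementable T c B].
Proof.
move=> Tmono sp; tfae.
- by move=> [c [B [c0 alB imp]]]; exact (implementable_maximal sp alB c0 Tmono imp).
- by move=> Tmax c B c0 alB; exact (maximal_implementable sp alB c0 Tmax).
- by move=> imp; exists 1, (daddv_pi Hs Hss); split=> //;
    [|apply: imp => //]; exact (aligned_daddv_pi sp).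
Qed.
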